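(* Let $f:X\to X$ be a continuous map on a metric space $(X,d)$, let $\overline{f}:\mathcal{K}(X)\to\mathcal{K}(X)$ be the induced map on the hyperspace of non-empty compact subsets of $X$, and let $\hat{f}$ be the Zadeh extension of $f$ to the space $\mathcal{F}(X)$ of normal fuzzy sets, where $\mathcal{F}_\infty(X)=(\mathcal{F}(X),d_\infty)$ and $\mathcal{F}_0(X)=(\mathcal{F}(X),d_0)$ denote this space with the supremum metric and with the Skorokhod metric, respectively. Then: (a) The following statements are equivalent: (i) $f_{(N)}:X^N\to X^N$ is topologically recurrent for every $N \in \mathbb{N}$; (ii) $\overline{f}:\mathcal{K}(X)\to \mathcal{K}(X)$ is topologically recurrent; (iii) $\hat{f}:\mathcal{F}_{\infty}(X)\to \mathcal{F}_{\infty}(X)$ is topologically recurrent; (iv) $\hat{f}:\mathcal{F}_{0}(X)\to \mathcal{F}_{0}(X)$ is topologically recurrent. (b) The following statements are equivalent: (i) $f_{(N)}:X^N\to X^N$ is multiply recurrent for every $N \in \mathbb{N}$; (ii) $\overline{f}:\mathcal{K}(X)\to \mathcal{K}(X)$ is multiply recurrent; (iii) $\hat{f}:\mathcal{F}_{\infty}(X)\to \mathcal{F}_{\infty}(X)$ is multiply recurrent; (iv) $\hat{f}:\mathcal{F}_{0}(X)\to \mathcal{F}_{0}(X)$ is multiply recurrent. (c) Given any Furstenberg family $\mathcal{A} \subset \mathscr{P}(\mathbb{N}_0)$, the following statements are equivalent: (i) $f_{(N)}:X^N\to X^N$ is topologically $\mathcal{A}$-recurrent for every $N \in \mathbb{N}$;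 (ii) $\overline{f}:\mathcal{K}(X)\to \mathcal{K}(X)$ is topologically $\mathcal{A}$-recurrent; (iii) $\hat{f}:\mathcal{F}_{\infty}(X)\to \mathcal{F}_{\infty}(X)$ is topologically $\mathcal{A}$-recurrent; (iv) $\hat{f}:\mathcal{F}_{0}(X)\to \mathcal{F}_{0}(X)$ is topologically $\mathcal{A}$-recurrent.
   Context: $\mathbb{N}$ is the set of strictly positive integers and $\mathbb{N}_0=\mathbb{N}\cup\{0\}$; $\mathscr{P}(\mathbb{N}_0)$ is the power set of $\mathbb{N}_0$. Furstenberg family: a collection $\mathcal{A}\subset\mathscr{P}(\mathbb{N}_0)$ that is hereditarily upward (if $A\in\mathcal{A}$ and $A\subset B\subset\mathbb{N}_0$, then $B\in\mathcal{A}$) and such that $\varnothing\notin\mathcal{A}$. For a continuous self-map $g:Y\to Y$ of a topological space $Y$ and $N\in\mathbb{N}$, $g_{(N)}:Y^N\to Y^N$ denotes the $N$-fold direct product $g_{(N)}(y_1,\dots,y_N)=(g(y_1),\dots,g(y_N))$, where $Y^N$ carries the product topology. A continuous self-map $g:Y\to Y$ of a topological space $Y$ is called: - topologically recurrent if for every non-empty open $U\subset Y$ there exists some $n\in\mathbb{N}$ such that $g^n(U)\cap U\neq\varnothing$; - multiply recurrent if for every $\ell\in\mathbb{N}$ and every non-empty open $U\subset Y$ there exists some $n\in\mathbb{N}$ such that $U\cap g^{-n}(U)\cap g^{-2n}(U)\cap\cdots\cap g^{-\ell n}(U)\neq\varnothing$; - topologically $\mathcal{A}$-recurrent if for every non-empty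 open $U\subset Y$ the set $\{n\in\mathbb{N}_0\;;\;g^n(U)\cap U\neq\varnothing\}$ belongs to $\mathcal{A}$. $\mathcal{K}(X)$ is the set of all non-empty compact subsets of $X$, endowed with the Vietoris topology, whose basic open sets are $\mathcal{V}(U_1,\dots,U_N)=\{K\in\mathcal{K}(X)\;;\;K\subset\bigcup_{j=1}^N U_j,\ K\cap U_j\neq\varnothing \text{ for all } 1\le j\le N\}$ with $N\in\mathbb{N}$ and $U_1,\dots,U_N\subset X$ non-empty open; for a metric space $(X,d)$ this is the topology of the Hausdorff metric $d_H(K_1,K_2)=\max\{\max_{x_1\in K_1}d(x_1,K_2),\max_{x_2\in K_2}d(x_2,K_1)\}$. The map $\overline{f}:\mathcal{K}(X)\to\mathcal{K}(X)$ is $\overline{f}(K):=f(K)$. Fuzzy sets: for a function $u:X\to[0,1]$ put $u_\alpha:=\{x\in X\;;\;u(x)\ge\alpha\}$ for $\alpha\in(0,1]$ and $u_0:=\overline{\{x\in X\;;\;u(x)>0\}}$ (closure in $X$). $\mathcal{F}(X)$ is the set of normal fuzzy sets: the upper-semicontinuous functions $u:X\to[0,1]$ such that $u_0$ is compact and $u_1$ is non-empty. Zadeh extension: $\hat{f}(u)(x):=\sup\{u(y)\;;\;y\in f^{-1}(x)\}$ if $f^{-1}(x)\neq\varnothing$, and $\hat{f}(u)(x):=0$ if $f^{-1}(x)=\varnothing$. For continuous $f$ on a metric space, $\hat f$ is a well-defined self-map of $\mathcal{F}(X)$, continuous for both metrics below. Supremum metric: $d_\infty(u,v):=\sup_{\alpha\in[0,1]}d_H(u_\alpha,v_\alpha)$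 for $u,v\in\mathcal{F}(X)$. Skorokhod metric: $d_0(u,v):=\inf\{\varepsilon\;;\;\text{there is }\xi\in\mathcal{T}\text{ with }\sup_{\alpha\in[0,1]}|\xi(\alpha)-\alpha|\le\varepsilon\text{ and }d_\infty(u,\xi\circ v)\le\varepsilon\}$, where $\mathcal{T}$ is the set of strictly increasing homeomorphisms $\xi:[0,1]\to[0,1]$. *)

(* Defs.v *)
From HB Require Import structures.
From mathcomp Require Import all_boot all_order all_algebra.
From mathcomp Require Import all_classical all_reals all_analysis.
From mathcomp Require Import ring lra.
Set Implicit Arguments.
Unset Strict Implicit.
Unset Printing Implicit Defensive.
Import Order.TTheory GRing.Theory Num.Theory.
Import numFieldTopology.Exports numFieldNormedType.Exports.
Local Open Scope classical_set_scope.
Local Open Scope ring_scope.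

Definition furstenberg_family (A : set (set nat)) : Prop :=
  (forall B C : set nat, A B -> B `<=` C -> A C) /\ ~ A set0.

Section recurrence.
Variables (Y : topologicalType) (g : Y -> Y).

Definition topologically_recurrent : Prop :=
  forall U : set Y, open U -> U !=set0 ->
    exists2 n, (0 < n)%N & (iter n g @` U) `&` U !=set0.

Definition multiply_recurrent : Prop :=
  forall l : nat, (0 < l)%N -> forall U : set Y, open U -> U !=set0 ->
    exists2 n, (0 < n)%N &
      \bigcap_(j in [set j | (j <= l)%N]) (iter (j * n) g @^-1` U) !=set0.

Definition family_recurrent (A : set (set nat)) : Prop :=
  forall U : set Y, open U -> U !=set0 ->
    A [set n | (iter n g @` U) `&` U !=set0].

End recurrence.

Definition power (X : topologicalType) (N : nat) : topologicalType :=
  {ptws 'I_N -> X}.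

Definition power_map (X : topologicalType) (f : X -> X) (N : nat)
  (y : power X N) : power X N := fun i => f (y i).

Record hyperspace (X : topologicalType) := Hyperspace {
  hyper_set :> set X ;
  hyper_compact : compact hyper_set ;
  hyper_neq0 : hyper_set !=set0 }.

HB.instance Definition _ (X : topologicalType) := gen_eqMixin (hyperspace X).
HB.instance Definition _ (X : topologicalType) :=
  gen_choiceMixin (hyperspace X).

Section vietoris.
Variable X : topologicalType.

Definition vietoris_set (N : nat) (U : 'I_N -> set X) : set (hyperspace X) :=
  [set K | (K : set X) `<=` \bigcup_i U i /\
           forall i, (K : set X) `&` U i !=set0].

Definition vietoris_base : set (set (hyperspace X)) :=
  [set W | exists N (U : 'I_N -> set X),
    [/\ (0 < N)%N, forall i, open (U i) /\ U i !=set0 & W = vietoris_set U]].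

Lemma vietoris_cover : \bigcup_(W in vietoris_base) idfun W = setT.
Proof.
rewrite -subTset => K _; have [x Kx] := hyper_neq0 K.
exists (@vietoris_set 1 (fun=> setT)).
  by exists 1%N, (fun=> setT); split=> // _; split; [exact: openT|exists x].
by split=> [y _|_]; [exists ord0|exists x].
Qed.

Lemma vietoris_join (V W : set (hyperspace X)) (K : hyperspace X) :
  vietoris_base V -> vietoris_base W -> idfun V K -> idfun W K ->
  exists S, [/\ vietoris_base S, idfun S K & idfun S `<=` idfun V `&` idfun W].
Proof.
move=> [n [U [_ oU ->]]] [m [U' [_ oU' ->]]] [KU KUi] [KU' KU'i].
pose P : pred ('I_n * 'I_m) :=
  [pred p | `[< (K : set X) `&` (U p.1 `&` U' p.2) !=set0 >]].
pose T (k : 'I_#|P|) := U (enum_val k).1 `&` U' (enum_val k).2.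
have TP i j x : hyper_set K x -> U i x -> U' j x ->
    exists k : 'I_#|P|, enum_val k = (i, j).
  move=> Kx Ux U'x; have Pij : (i, j) \in P by apply/asboolP; exists x.
  by exists (enum_rank_in Pij (i, j)); rewrite enum_rankK_in.
exists (vietoris_set T); split.
- exists #|P|, T; split=> // [|k].
    have [x Kx] := hyper_neq0 K.
    have [i _ Ux] := KU _ Kx; have [j _ U'x] := KU' _ Kx.
    by have [k _] := TP i j x Kx Ux U'x; apply: leq_ltn_trans (ltn_ord k).
  split; first by apply: openI; [exact: (oU _).1|exact: (oU' _).1].
  by have /asboolP[x [_ Tx]] := enum_valP k; exists x.
- split=> [x Kx|k]; last exact/asboolP/(enum_valP k).
  have [i _ Ux] := KU _ Kx; have [j _ U'x] := KU' _ Kx.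
  by have [k kE] := TP i j x Kx Ux U'x; exists k => //; rewrite /T kE.
- move=> L [LT LTi]; split; split.
  + by move=> x /LT[k _ []]; exists (enum_val k).1.
  + move=> i; have [x [Kx Ux]] := KUi i; have [j _ U'x] := KU' _ Kx.
    have [k kE] := TP i j x Kx Ux U'x.
    by have [y [Ly]] := LTi k; rewrite /T kE => -[]; exists y.
  + by move=> x /LT[k _ []]; exists (enum_val k).2.
  + move=> j; have [x [Kx U'x]] := KU'i j; have [i _ Ux] := KU _ Kx.
    have [k kE] := TP i j x Kx Ux U'x.
    by have [y [Ly]] := LTi k; rewrite /T kE => -[]; exists y.
Qed.

HB.instance Definition _ :=
  isBaseTopological.Build (hyperspace X) vietoris_cover vietoris_join.

End vietoris.

Definition hyper_map (X : topologicalType) (f : X -> X) (hf : continuous f)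
    (K : hyperspace X) : hyperspace X :=
  Hyperspace
    (continuous_compact (continuous_subspaceT hf) (@hyper_compact X K))
    (image_nonempty f (@hyper_neq0 X K)).

Section fuzzy_functions.
Variables (R : realType) (X : metricType R).
Implicit Types (u v : X -> R) (K L : set X).

Definition level u (a : R) : set X :=
  if a == 0 then closure [set x | 0 < u x] else [set x | a <= u x].

Definition upper_semicontinuous u : Prop :=
  forall x a, u x < a -> \forall y \near x, u y < a.

Record normal_fuzzy u : Prop := NormalFuzzy {
  normal_fuzzy01 : forall x, 0 <= u x <= 1 ;
  normal_fuzzy_usc : upper_semicontinuous u ;
  normal_fuzzy_compact : compact (level u 0) ;
  normal_fuzzy_neq0 : level u 1 !=set0 }.

(* The real inf and sup below are meaningful for non-empty compact sets and for
   normal fuzzy functions, where the sets involved are non-empty and bounded.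
   The two inner suprema of hausdorff_dist are then maxima. *)
Definition point_dist (x : X) K : R := inf [set mdist x y | y in K].

Definition hausdorff_dist K L : R :=
  Num.max (sup [set point_dist x L | x in K])
          (sup [set point_dist y K | y in L]).

Definition dist_sup u v : R :=
  sup [set hausdorff_dist (level u a) (level v a) | a in `[0, 1]].

(* Homeomorphisms of [0, 1] are represented by functions on R, of which only
   the restriction to [0, 1] matters. *)
Definition increasing_homeo (xi : R -> R) : Prop :=
  {in `[0, 1] &, {homo xi : s t / s < t}} /\
  exists zeta : R -> R,
    [/\ set_fun `[0, 1] `[0, 1] xi, set_fun `[0, 1] `[0, 1] zeta,
        {in `[0, 1], cancel xi zeta} /\ {in `[0, 1], cancel zeta xi},
        {within `[0, 1], continuous xi} & {within `[0, 1], continuous zeta}].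

Definition dist_skorokhod u v : R :=
  inf [set e | exists xi : R -> R, [/\ increasing_homeo xi,
    sup [set `|xi a - a| | a in `[0, 1]] <= e & dist_sup u (xi \o v) <= e]].

Definition zadeh_fun (f : X -> X) u (x : X) : R :=
  if pselect (f @^-1` [set x] !=set0) then sup (u @` (f @^-1` [set x])) else 0.

End fuzzy_functions.

Record fuzzy (R : realType) (X : metricType R) := Fuzzy {
  fuzzy_fun :> X -> R ;
  fuzzyP : normal_fuzzy fuzzy_fun }.

HB.instance Definition _ R X := gen_eqMixin (@fuzzy R X).
HB.instance Definition _ R X := gen_choiceMixin (@fuzzy R X).

(* The topology induced by a distance. *)
Section dist_topology.
Variables (R : realType) (T : Type) (d : T -> T -> R).

Definition dist_open : set (set T) := [set U | forall x, U x ->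
  exists2 e : R, 0 < e & [set y | d x y < e] `<=` U].

Lemma dist_openT : dist_open setT.
Proof. by move=> x _; exists 1. Qed.

Lemma dist_openI : setI_closed dist_open.
Proof.
move=> U V oU oV x [/oU[e e0 eU] /oV[e' e'0 eV]].
exists (Num.min e e'); first by rewrite lt_min e0.
by move=> y /=; rewrite lt_min => /andP[xe xe']; split; [exact: eU|exact: eV].
Qed.

Lemma dist_open_bigU (I : Type) (U : I -> set T) :
  (forall i, dist_open (U i)) -> dist_open (\bigcup_i U i).
Proof.
move=> oU x [i _ /oU[e e0 eU]]; exists e => // y /eU Uy; by exists i.
Qed.

End dist_topology.

Section fuzzy_spaces.
Variables (R : realType) (X : metricType R).

(* Two copies of the same type, one for each of the two topologies. *)
Definition fuzzy_sup : Type := fuzzy X.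
Definition fuzzy_skorokhod : Type := fuzzy X.

HB.instance Definition _ := Choice.on fuzzy_sup.
HB.instance Definition _ := Choice.on fuzzy_skorokhod.

Let d_sup (u v : fuzzy_sup) : R :=
  dist_sup (u : fuzzy X) (v : fuzzy X).
Let d_skorokhod (u v : fuzzy_skorokhod) : R :=
  dist_skorokhod (u : fuzzy X) (v : fuzzy X).

HB.instance Definition _ := isOpenTopological.Build fuzzy_sup
  (dist_openT d_sup) (@dist_openI _ _ d_sup) (@dist_open_bigU _ _ d_sup).

HB.instance Definition _ := isOpenTopological.Build fuzzy_skorokhod
  (dist_openT d_skorokhod) (@dist_openI _ _ d_skorokhod)
  (@dist_open_bigU _ _ d_skorokhod).

End fuzzy_spaces.

Section zadeh.
Variables (R : realType) (X : metricType R) (f : X -> X).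
Hypothesis hf : continuous f.

Section zadeh_normal.
Variable u : X -> R.
Hypothesis hu : normal_fuzzy u.

Let u_ge0 x : 0 <= u x. Proof. by have /andP[] := normal_fuzzy01 hu x. Qed.
Let u_le1 x : u x <= 1. Proof. by have /andP[] := normal_fuzzy01 hu x. Qed.

Let zadeh_ub x : ubound (u @` (f @^-1` [set x])) 1.
Proof. by move=> _ [y _ <-]. Qed.

Let zadeh_ge y : u y <= zadeh_fun f u (f y).
Proof.
rewrite /zadeh_fun; case: pselect => [?|nf]; last by case: nf; exists y.
by apply: ub_le_sup; [exists 1; exact: zadeh_ub|exists y].
Qed.

Let zadeh01 x : 0 <= zadeh_fun f u x <= 1.
Proof.
rewrite /zadeh_fun; case: pselect => [[y fy]|?]; last by rewrite lexx ler01.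
apply/andP; split.
  apply: le_trans (u_ge0 y) _.
  by apply: ub_le_sup; [exists 1; exact: zadeh_ub|exists y].
by apply: ge_sup; [exists (u y), y|exact: zadeh_ub].
Qed.

Let closed_sup_level a : closed [set x | a <= u x].
Proof.
rewrite -openC openE => x /= /negP; rewrite -ltNge => uxa.
apply: filterS (normal_fuzzy_usc hu uxa) => y uya /=.
by apply/negP; rewrite -ltNge.
Qed.

Let compact_sup_level a : 0 < a -> compact [set x | a <= u x].
Proof.
move=> a0; apply: (subclosed_compact _ (normal_fuzzy_compact hu)) => // x /= ax.
by rewrite /level eqxx; apply: subset_closure => /=; exact: lt_le_trans ax.
Qed.

Let zadeh_attained a x : 0 < a -> a <= zadeh_fun f u x ->
  exists2 y, f y = x & a <= u y.
Proof.
move=> a0; rewrite /zadeh_fun; case: pselect => [f0|?]; last first.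
  by rewrite leNgt a0.
move=> ax; apply: contrapT => noy.
have fua y : f y = x -> u y < a.
  by move=> fy; rewrite ltNge; apply/negP => a_le; apply: noy; exists y.
pose C := [set y | a / 2 <= u y] `&` f @^-1` [set x].
have cC : compact C.
  apply: compact_closedI; first by apply: compact_sup_level; rewrite divr_gt0.
  apply: (proj1 (continuous_closedP f) hf).
  by apply: accessible_closed_set1; apply: hausdorff_accessible;
    exact: metric_hausdorff.
have : \forall e \near (0 : R)^'+, forall y, C y -> u y < a - e.
  move/compact_near_coveringP : cC.
  apply => y [_ fy]; have uya := fua _ fy.
  have d0 : 0 < (a - u y) / 2 by rewrite divr_gt0// subr_gt0.
  exists ([set z | u z < (u y + a) / 2], [set e | e < (a - u y) / 2]) => /=.
    split; last exact: nbhs_right_lt.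
    by apply: (normal_fuzzy_usc hu); rewrite midf_lt.
  move=> [z e] /= [uz ez]; lra.
move=> nearC.
have [e [e0 Ce]] : exists e : R, 0 < e /\ forall y, C y -> u y < a - e.
  near (0 : R)^'+ => e; exists e; split; first by near: e; exact: nbhs_right_gt.
  by near: e.
have : sup (u @` (f @^-1` [set x])) <= Num.max (a - e) (a / 2).
  apply: ge_sup; first by have [y fy] := f0; exists (u y), y.
  move=> _ [y fy <-]; rewrite le_max.
  have [uy|uy] := leP (a / 2) (u y); last by rewrite (ltW uy) orbT.
  by rewrite ltW//; apply: Ce.
move/(le_trans ax); rewrite le_max => /orP[]; lra.
Unshelve. all: by end_near. Qed.

Let zadeh_level a : 0 < a ->
  [set x | a <= zadeh_fun f u x] = f @` [set x | a <= u x].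
Proof.
move=> a0; apply/seteqP; split=> [x /= /(zadeh_attained a0)[y fy ay]|].
  by exists y.
by move=> _ [y /= ay <-] /=; apply: le_trans ay (zadeh_ge y).
Qed.

Let compact_image K : compact K -> compact (f @` K).
Proof. by apply: continuous_compact; exact: continuous_subspaceT. Qed.

Let compact_closed_image K : compact K -> closed (f @` K).
Proof.
by move=> cK; apply: compact_closed; [exact: metric_hausdorff|exact: compact_image].
Qed.

Lemma zadeh_normal : normal_fuzzy (zadeh_fun f u).
Proof.
split.
- exact: zadeh01.
- move=> x a xa; have a0 : 0 < a.
    by apply: le_lt_trans xa; have /andP[] := zadeh01 x.
  have : closed [set x | a <= zadeh_fun f u x].
    by rewrite zadeh_level//; apply: compact_closed_image; exact: compact_sup_level.
  rewrite -openC openE => /(_ x); rewrite /= => H; apply: filterS (H _); last first.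
    by apply/negP; rewrite -ltNge.
  by move=> y /= /negP; rewrite -ltNge.
- have cu := normal_fuzzy_compact hu.
  rewrite {1}/level eqxx.
  apply: (subclosed_compact _ (compact_image cu)); first exact: closed_closure.
  rewrite closureE => x /(_ (f @` level u 0)); apply; split.
    exact: compact_closed_image.
  move=> y /= y0; have [z fz uz] := zadeh_attained y0 (lexx _).
  exists z => //; rewrite /level eqxx; apply: subset_closure => /=.
  exact: lt_le_trans uz.
- have [x] := normal_fuzzy_neq0 hu.
  rewrite /level oner_eq0 /= => ux; exists (f x) => /=.
  exact: le_trans ux (zadeh_ge x).
Qed.

End zadeh_normal.

Definition zadeh (u : fuzzy X) : fuzzy X := Fuzzy (zadeh_normal (fuzzyP u)).

Definition zadeh_sup : fuzzy_sup X -> fuzzy_sup X := zadeh.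

Definition zadeh_skorokhod : fuzzy_skorokhod X -> fuzzy_skorokhod X := zadeh.

End zadeh.

(* Main.v *)
(** All three notions of recurrence of [g] are monotone conditions on the sets of
    pairs [(l, n)] such that some point [x] satisfies [iter (j * n) g x \in U]
    for every [j <= l], with [U] ranging over the non-empty open sets. So it
    suffices, for each implication, to find for every non-empty open set of the
    target system one of the source system with fewer such pairs.
    From powers to the hyperspace, use finite sets. From the hyperspace to powers,
    discard one after the other the factors that can be reached from another one,
    until a returning compact set cannot permute the factors. From powers to
    fuzzy sets, use that finitely supported fuzzy sets are dense for the supremum
    metric: in each ball of a finite cover of the support of [u] keep a maximum
    point of [u]. The supremum metric dominates the Skorokhod metric, and for the
    latter [u |-> u_1] is still continuous, which leads back to the hyperspace. *)

Require Import Defs.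
From mathcomp Require Import all_boot all_order all_algebra.
From mathcomp Require Import all_classical all_reals all_analysis.
From mathcomp Require Import lra.
Set Implicit Arguments.
Unset Strict Implicit.
Unset Printing Implicit Defensive.
Local Open Scope classical_set_scope.
Local Open Scope ring_scope.
Import Order.TTheory GRing.Theory Num.Theory.
Import numFieldTopology.Exports numFieldNormedType.Exports.

(** * Return sets and the three notions of recurrence *)

Section return_set.
Variables (Y : topologicalType) (g : Y -> Y).

Definition return_set (U : set Y) : set (nat * nat) :=
  [set ln | exists x, forall j, (j <= ln.1)%N -> U (iter (j * ln.2) g x)].

Definition return_property (P : set (nat * nat) -> Prop) : Prop :=
  forall U : set Y, open U -> U !=set0 -> P (return_set U).

Lemma return_set1 (U : set Y) n :
  return_set U (1%N, n) <-> (iter n g @` U) `&` U !=set0.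
Proof.
split=> [[x Ux]|[_ [[x Ux <-] Unx]]].
  exists (iter n g x); split; last by have := Ux 1%N isT; rewrite mul1n.
  by exists x => //; exact: (Ux 0%N isT).
by exists x => -[|[|//]] _; rewrite ?mul0n ?mul1n.
Qed.

Lemma topologically_recurrentE : topologically_recurrent g <->
  return_property (fun S => exists2 n, (0 < n)%N & S (1%N, n)).
Proof.
by split=> gP U oU U0; have [n n0 Un] := gP U oU U0;
  exists n => //; apply/return_set1.
Qed.

Lemma multiply_recurrentE : multiply_recurrent g <->
  return_property (fun S =>
    forall l, (0 < l)%N -> exists2 n, (0 < n)%N & S (l, n)).
Proof.
split=> [gP U oU U0 l l0|gP l l0 U oU U0].
  by have [n n0 [x Ux]] := gP l l0 U oU U0; exists n => //; exists x.
by have [n n0 [x Ux]] := gP U oU U0 l l0; exists n => //; exists x.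
Qed.

Lemma family_recurrentE (A : set (set nat)) : family_recurrent g A <->
  return_property (fun S => A [set n | S (1%N, n)]).
Proof.
have retE U : [set n | return_set U (1%N, n)] =
    [set n | (iter n g @` U) `&` U !=set0].
  by apply/seteqP; split=> n /return_set1.
by split=> gP U oU U0; have := gP U oU U0; rewrite retE.
Qed.

End return_set.

(** * Comparison of finite powers with the hyperspace *)

Section power_hyperspace.
Variables (X : topologicalType) (f : X -> X).
Hypothesis hf : continuous f.

Let continuous_iter n : continuous (iter n f).
Proof.
elim: n => [|n IHn] x /=; first exact: cvg_id.
by apply: continuous_comp; [exact: IHn|exact: hf].
Qed.

Lemma iter_power_map N n (y : power X N) i :
  iter n (@power_map X f N) y i = iter n f (y i).
Proof. by elim: n => //= n IHn; rewrite /power_map IHn. Qed.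

Definition box N (V : 'I_N -> set X) : set (power X N) :=
  [set y : power X N | forall i, V i (y i)].

Lemma open_box N (V : 'I_N -> set X) :
  (forall i, open (V i)) -> open (box V).
Proof.
move=> oV; rewrite openE => y Vy.
apply: (@filter_forall _ _ (fun i (z : power X N) => V i (z i)) _
  (nbhs_filter y)) => i.
apply: (@proj_continuous _ (fun=> X) i y).
by apply: open_nbhs_nbhs; split; [exact: oV|exact: Vy].
Qed.

(** The filter generated by the boxes around [x] converges to [x]; for the product topology this is
    checked one coordinate at a time. *)
Lemma box_subset N (U : set (power X N)) (x : power X N) : open U -> U x ->
  exists V : 'I_N -> set X,
    (forall i, open (V i) /\ V i (x i)) /\ box V `<=` U.
Proof.
move=> oU Ux.
pose D (V : 'I_N -> set X) := forall i, open (V i) /\ V i (x i).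
pose F := filter_from D (@box N).
have FF : Filter F.
  apply: filter_from_filter.
    by exists (fun=> setT) => i; split=> //; exact: openT.
  move=> V W DV DW; exists (fun i => V i `&` W i) => [i|y VWy].
    have [oV Vx] := DV i; have [oW Wx] := DW i.
    by split; [exact: openI|].
  by split=> i; have [] := VWy i.
have : F --> (x : prod_topology (fun=> X)).
  apply/cvg_sup => i P [B [[W oW <-] Wx] BP].
  (* The box that restricts only the coordinate [i]. *)
  exists (fun k => if k == i then W else setT).
    by move=> k; case: eqP => [->|_]; split=> //; exact: openT.
  by move=> y Vy; apply: BP; have := Vy i; rewrite eqxx.
move=> /(_ U (open_nbhs_nbhs (conj oU Ux))) [V DV VU].
by exists V.
Qed.

Lemma return_set_box N (V : 'I_N -> set X) ln :
  return_set (@power_map X f N) (box V) ln <->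
  forall i, return_set f (V i) ln.
Proof.
split=> [[y Vy] i|].
  by exists (y i) => j /Vy/(_ i); rewrite iter_power_map.
move=> /choice[y Vy]; exists y => j jl i.
by rewrite iter_power_map; exact: Vy.
Qed.

Lemma iter_hyper_map n (K : hyperspace X) :
  iter n (hyper_map hf) K = iter n f @` K :> set X.
Proof.
elim: n => [|n IHn] /=; first by rewrite image_id.
by rewrite IHn image_comp.
Qed.

Lemma open_vietoris_set N (U : 'I_N -> set X) : (0 < N)%N ->
  (forall i, open (U i) /\ U i !=set0) -> open (vietoris_set U).
Proof.
move=> N0 oU; exists [set vietoris_set U].
  by move=> _ ->; exists N, U.
by rewrite bigcup_set1.
Qed.

Lemma vietoris_subset (U : set (hyperspace X)) (K : hyperspace X) :
  open U -> U K -> exists N (V : 'I_N -> set X),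
    [/\ (0 < N)%N, forall i, open (V i) /\ V i !=set0,
        vietoris_set V K & vietoris_set V `<=` U].
Proof.
move=> [B BV <-] [W BW WK]; have [N [V [N0 oV WE]]] := BV _ BW.
exists N, V; rewrite -WE; split=> // L WL; by exists W.
Qed.

(* The range of [y] has the same pattern of returns to [V 0, .., V (N - 1)] as
   the tuple [y]. *)
Lemma return_set_hyper_power (U : set (hyperspace X)) : open U -> U !=set0 ->
  exists (N : nat) (W : set (power X N)),
    [/\ (0 < N)%N, open W, W !=set0 &
      return_set (@power_map X f N) W `<=` return_set (hyper_map hf) U].
Proof.
move=> oU [K UK]; have [N [V [N0 oV VK VU]]] := vietoris_subset oU UK.
exists N, (box V); split=> //.
- by apply: open_box => i; exact: (oV i).1.
- have /choice[x Vx] : forall i, exists x, V i x by move=> i; exact: (oV i).2.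
  by exists x.
- move=> [l n] [y Vy].
  have y_compact : compact (range y).
    by apply/finite_compact/finite_image/finite_finset.
  have y_neq0 : range y !=set0 by exists (y (Ordinal N0)), (Ordinal N0).
  exists (Hyperspace y_compact y_neq0) => j jl; apply: VU.
  rewrite /vietoris_set/= iter_hyper_map /=; split.
    move=> _ [_ [i _ <-] <-]; exists i => //.
    by have := Vy j jl i; rewrite iter_power_map.
  move=> i; exists (iter (j * n) f (y i)); split.
    by exists (y i) => //; exists i.
  by have := Vy j jl i; rewrite iter_power_map.
Qed.

Lemma hyperspace_of_points N (x : 'I_N.+1 -> X) :
  exists K : hyperspace X, K = range x :> set X.
Proof.
have x_compact : compact (range x).
  by apply/finite_compact/finite_image/finite_finset.
have x_neq0 : range x !=set0 by exists (x ord0), ord0.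
by exists (Hyperspace x_compact x_neq0).
Qed.

(** Orbits starting in [V i] meet no other set of the family. A point of [L] in [V i] stays, at each
    return of [L], in the union of the sets, hence in [V i]. *)
Lemma return_set_vietoris_set N (V : 'I_N -> set X) ln i :
  (forall i j n x, V i x -> V j (iter n f x) -> i = j) ->
  return_set (hyper_map hf) (vietoris_set V) ln -> return_set f (V i) ln.
Proof.
case: ln => l n V_fixed [L VL]; have [x [Lx Vx]] := (VL 0%N isT).2 i.
exists x => j /VL[+ _]; rewrite iter_hyper_map => /(_ (iter (j * n) f x)).
case=> [|k _ Vk]; first by exists x.
by rewrite (V_fixed _ _ _ _ Vx Vk).
Qed.

Lemma vietoris_set_fixed N (V : 'I_N.+1 -> set X) :
  (forall i, open (V i) /\ V i !=set0) ->
  (forall i j n x, V i x -> V j (iter n f x) -> i = j) ->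
  exists W : set (hyperspace X), [/\ open W, W !=set0 &
    forall ln, return_set (hyper_map hf) W ln ->
      forall i, return_set f (V i) ln].
Proof.
move=> oV V_fixed; exists (vietoris_set V).
split; [exact: open_vietoris_set| |]; last first.
  by move=> ln /return_set_vietoris_set + i; apply.
have /choice[x Vx] : forall i, exists x, V i x by move=> i; exact: (oV i).2.
have [K KE] := hyperspace_of_points x; exists K.
rewrite /vietoris_set/= KE; split=> [_ [i _ <-]|i]; first by exists i.
by exists (x i); split=> //; exists i.
Qed.

(* A compact set returning to [vietoris_set V] may permute the sets [V i]. If
   some iterate of [f] sends a point of [V i] into [V j] with [i <> j], then
   every return of [V i `&` iter n f @^-1` V j] to itself is also a return of
   [V j], so that [V j] can be discarded; otherwise no permutation can occur. *)
Lemma return_set_vietoris N (V : 'I_N.+1 -> set X) :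
  (forall i, open (V i) /\ V i !=set0) ->
  exists W : set (hyperspace X), [/\ open W, W !=set0 &
    forall ln, return_set (hyper_map hf) W ln ->
      forall i, return_set f (V i) ln].
Proof.
elim: N V => [|N IHN] V oV; have [V_fixed|] := pselect (forall i j n x,
  V i x -> V j (iter n f x) -> i = j).
- exact: vietoris_set_fixed.
- by case=> i j n x _ _; rewrite (ord1 i) (ord1 j).
- exact: vietoris_set_fixed.
move=> /existsNP[i] /existsNP[j] /existsNP[n] /existsNP[x].
move=> /not_implyP[Vx] /not_implyP[Vnx ij].
pose V' k := if k == i then V i `&` (iter n f @^-1` V j) else V k.
have V'V k : V' k `<=` V k by move=> y; rewrite /V'; case: eqP => [-> []|].
(* [lift j] enumerates the indices other than [j], so the induction applies to the shrunk family
   without [V j]. *)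
have [k|W [oW W0 WV]] := IHN (fun k => V' (lift j k)).
  rewrite /V'; case: eqP => // _; split; last by exists x.
  apply: openI; first exact: (oV i).1.
  by apply: open_comp => [y _|]; [exact: continuous_iter|exact: (oV j).1].
exists W; split=> // -[l m] /WV V'lm k.
have [k' ->|->] := unliftP j k.
  by have [y Vy] := V'lm k'; exists y => a /Vy/V'V.
(* Only the discarded index [j] is left. Since [i] was kept, a point [y] returns to the shrunk
   [V i]; as iterates commute, [iter n f y] returns to [V j]. *)
have [i' iE|//] := unliftP j i.
have [y] := V'lm i'; rewrite -iE /V' eqxx => Vy.
exists (iter n f y) => a al.
by rewrite -iterD addnC iterD; exact: (Vy a al).2.
Qed.

Lemma return_set_power_hyper N (U : set (power X N)) : (0 < N)%N ->
  open U -> U !=set0 ->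
  exists W : set (hyperspace X), [/\ open W, W !=set0 &
    return_set (hyper_map hf) W `<=` return_set (@power_map X f N) U].
Proof.
case: N U => // N U _ oU [x Ux]; have [V [oV VU]] := box_subset oU Ux.
have [i|W [oW W0 WV]] := @return_set_vietoris N V.
  by split; [exact: (oV i).1|exists (x i); exact: (oV i).2].
exists W; split=> // ln /WV/return_set_box[y Vy].
by exists y => j /Vy /VU.
Qed.

End power_hyperspace.

(** * Level sets of fuzzy functions *)

Section fuzzy_level_sets.
Variables (R : realType) (X : metricType R).
Implicit Types (u v : X -> R) (A B K : set X).

(** This agrees with [level u a] for [a <> 0] but takes no closure at height 0, so that at positive
    heights it commutes with images under [f]. *)
Definition superlevel u (a : R) : set X := [set x | a <= u x].

Lemma closed_superlevel u a : upper_semicontinuous u -> closed (superlevel u a).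
Proof.
move=> u_usc; rewrite -openC openE => x /= /negP; rewrite -ltNge => uxa.
apply: filterS (u_usc _ _ uxa) => y uya /=.
by apply/negP; rewrite -ltNge.
Qed.

Lemma compact_superlevel u a :
  normal_fuzzy u -> 0 < a -> compact (superlevel u a).
Proof.
move=> hu a0; apply: subclosed_compact (normal_fuzzy_compact hu) _.
  exact: closed_superlevel (normal_fuzzy_usc hu).
move=> x ax; rewrite /level eqxx; apply: subset_closure => /=.
exact: lt_le_trans ax.
Qed.

Lemma level1E u : level u 1 = superlevel u 1.
Proof. by rewrite /level oner_eq0. Qed.

(* Compactness applied to the filter generated by the sets of points of [K]
   where [u] is large. *)
Lemma usc_compact_max u K : upper_semicontinuous u -> compact K -> K !=set0 ->
  exists2 y, K y & forall x, K x -> u x <= u y.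
Proof.
move=> u_usc cK [x0 Kx0]; apply: contrapT => nomax.
have larger x : K x -> exists2 y, K y & u x < u y.
  move=> Kx; apply: contrapT => nlt; apply: nomax; exists x => // y Ky.
  by rewrite leNgt; apply/negP => xy; apply: nlt; exists y.
pose B y := [set z | K z /\ u y <= u z].
have FB : Filter (filter_from K B).
  apply: filter_from_filter; first by exists x0.
  move=> y z Ky Kz; have [yz|zy] := leP (u y) (u z).
    by exists z => // t [Kt zt]; split; split=> //; exact: le_trans zt.
  by exists y => // t [Kt yt]; split; split=> //; exact: le_trans (ltW zy) yt.
(* Without a maximum, each [x] in [K] lies below some [u y], and so do nearby points. Compactness
   gives one [B y] on which [u] exceeds all its values on [K], which is absurd at [y] itself. *)
move/compact_near_coveringP : cK.
move=> /(_ X (filter_from K B) (fun z x => u x < u z) FB).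
case=> [x Kx|y Ky yB].
  have [y Ky xy] := larger x Kx.
  exists ([set x' | u x' < u y], B y) => /=.
    by split; [exact: u_usc|exists y].
  by move=> [x' z] /= [x'y [_ yz]]; exact: lt_le_trans yz.
by have := yB y (conj Ky (lexx _)) y Ky; rewrite ltxx.
Qed.

(* Around each point of the support, take a point of the closed ball where [u]
   is maximal. *)
Lemma fuzzy_net u (e : R) : normal_fuzzy u -> 0 < e -> exists s : seq X,
  forall x, 0 < u x -> exists2 y, y \in s & mdist x y < e /\ u x <= u y.
Proof.
(* Finite sequences are filtered by inclusion: compactness then merges the local nets into a single
   one. *)
move=> hu e0; pose B (s : seq X) := [set t : seq X | {subset s <= t}].
have FB : Filter (filter_from setT B).
  apply: filter_fromT_filter; first by exists [::].
  move=> s t; exists (s ++ t) => r str.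
  by split=> z zs; apply: str; rewrite mem_cat zs ?orbT.
have /compact_near_coveringP := normal_fuzzy_compact hu.
move=> /(_ _ (filter_from setT B) (fun s x => 0 < u x ->
  exists2 y, y \in s & mdist x y < e /\ u x <= u y) FB).
case=> [p up|s _ sB]; last first.
  exists s => x ux; apply: (sB s) => //.
  by rewrite /level eqxx; exact: subset_closure.
(* The closure makes [C] compact, so that a maximum exists. Its points are within [3 * e / 4] of
   each point of the ball. *)
pose C := level u 0 `&` closure (ball p (e / 4)).
have e4 : 0 < e / 4 by rewrite divr_gt0.
have cC : compact C.
  by apply: compact_closedI; [exact: normal_fuzzy_compact|exact: closed_closure].
have Cp : C p by split=> //; apply: subset_closure; exact: ballxx.
have [|m [_ pm] mC] := usc_compact_max (normal_fuzzy_usc hu) cC.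
  by exists p.
exists (ball p (e / 4), B [:: m]) => /=.
  by split; [exact: nbhsx_ballx|exists [:: m]].
move=> [x s] /= [px ms] ux; exists m; first by apply: ms; rewrite mem_head.
split; last first.
  apply: mC; split; last exact: subset_closure.
  by rewrite /level eqxx; exact: subset_closure.
have [z [pz mz]] := pm _ (nbhsx_ballx m _ e4).
move: px pz mz; rewrite !ballEmdist /= => px pz mz.
have := metric_triangle x p m; have := metric_triangle p z m.
rewrite (metric_sym x p) (metric_sym z m); lra.
Qed.

(** One half of Hausdorff closeness, free of suprema and infima and hence of their default
    values. *)
Definition within_dist (e : R) A B : Prop :=
  forall x, A x -> exists2 y, B y & mdist x y < e.

Lemma within_dist_closure e A B :
  0 < e -> within_dist e A B -> within_dist (e + e) (closure A) (closure B).
Proof.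
move=> e0 AB x /(_ _ (nbhsx_ballx x _ e0)) [y [/AB[z Bz yz]]].
rewrite ballEmdist /= => xy; exists z; first exact: subset_closure.
by apply: le_lt_trans (metric_triangle x y z) _; rewrite ltrD.
Qed.

Lemma point_dist_ge0 x A : 0 <= point_dist x A.
Proof.
have [[y Ay]|A0] := pselect (A !=set0).
  apply: lb_le_inf; first by exists (mdist x y), y.
  by move=> _ [z _ <-]; exact: mdist_ge0.
(* The infimum of the empty set is 0 by convention. *)
rewrite /point_dist (_ : [set _ | _ in _] = set0) ?inf0//.
by apply/seteqP; split=> // r [y Ay _]; apply: A0; exists y.
Qed.

Lemma sup_ge0 (S : set R) : (forall r, S r -> 0 <= r) -> 0 <= sup S.
Proof.
move=> S_ge0; have [[[r Sr] S_ub]|nS] := pselect (has_sup S).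
  exact: le_trans (S_ge0 _ Sr) (ub_le_sup S_ub Sr).
(* An empty or unbounded set has supremum 0 by convention. *)
by rewrite sup_out.
Qed.

Lemma hausdorff_dist_ge0 A B : 0 <= hausdorff_dist A B.
Proof.
by rewrite le_max sup_ge0// => _ [x _ <-]; exact: point_dist_ge0.
Qed.

Lemma dist_sup_ge0 u v : 0 <= dist_sup u v.
Proof. by apply: sup_ge0 => _ [a _ <-]; exact: hausdorff_dist_ge0. Qed.

Lemma point_dist_le x y A : A y -> point_dist x A <= mdist x y.
Proof.
by move=> Ay; apply: ge_inf; [exists 0 => _ [z _ <-]; exact: mdist_ge0|exists y].
Qed.

Lemma hausdorff_dist_le e A B : A !=set0 -> B !=set0 ->
  within_dist e A B -> within_dist e B A -> hausdorff_dist A B <= e.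
Proof.
move=> [x Ax] [y By] AB BA; rewrite ge_max; apply/andP; split.
  apply: ge_sup; first by exists (point_dist x B), x.
  by move=> _ [z /AB[t Bt /ltW zt] <-]; exact: le_trans (point_dist_le _ Bt) zt.
apply: ge_sup; first by exists (point_dist y A), y.
by move=> _ [z /BA[t Bt /ltW zt] <-]; exact: le_trans (point_dist_le _ Bt) zt.
Qed.

(** The positive superlevel sets exhaust the set where the function is positive, so they control
    height 0 too; the closure taken there costs the second [e]. *)
Lemma dist_sup_le e u v : 0 < e ->
  superlevel u 1 !=set0 -> superlevel v 1 !=set0 ->
  (forall a, 0 < a -> within_dist e (superlevel u a) (superlevel v a)) ->
  (forall a, 0 < a -> within_dist e (superlevel v a) (superlevel u a)) ->
  dist_sup u v <= e + e.
Proof.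
move=> e0 [x ux] [y vy] uv vu; apply: ge_sup.
  exists (hausdorff_dist (level u 0) (level v 0)), 0 => //=.
  by rewrite in_itv/= lexx ler01.
move=> _ [a /= + <-]; rewrite in_itv/= => /andP[a0 a1].
have [->|aN0] := eqVneq a 0; rewrite /level ?eqxx ?(negbTE aN0).
  have supp_within w t :
      (forall b, 0 < b -> within_dist e (superlevel w b) (superlevel t b)) ->
      within_dist e [set z | 0 < w z] [set z | 0 < t z].
    (* Use the superlevel set at the point's own height [w z]. *)
    move=> wt z /= wz; have [z' tz' zz'] := wt _ wz z (lexx _).
    by exists z' => //; exact: lt_le_trans tz'.
  apply: hausdorff_dist_le.
  - by exists x; apply: subset_closure => /=; exact: lt_le_trans ux.
  - by exists y; apply: subset_closure => /=; exact: lt_le_trans vy.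
  - by apply: within_dist_closure => //; exact: supp_within.
  - by apply: within_dist_closure => //; exact: supp_within.
have {a0 aN0}a0 : 0 < a by rewrite lt_neqAle eq_sym aN0.
have widen w t : within_dist e (superlevel w a) (superlevel t a) ->
    within_dist (e + e) [set z | a <= w z] [set z | a <= t z].
  move=> wt z /wt[z' tz' zz']; exists z' => //; lra.
apply: hausdorff_dist_le; [by exists x; exact: le_trans ux|
  by exists y; exact: le_trans vy|exact/widen/uv|exact/widen/vu].
Qed.

Section zadeh_levels.
Variable f : X -> X.
Hypothesis hf : continuous f.

(** The point is that the supremum over a fibre is attained when it is positive. *)
Lemma zadeh_superlevel u a : normal_fuzzy u -> 0 < a ->
  superlevel (zadeh_fun f u) a = f @` superlevel u a.
Proof.
move=> hu a0.
have u_le1 y : u y <= 1 by have /andP[] := normal_fuzzy01 hu y.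
have ub_fiber x : has_ubound (u @` (f @^-1` [set x])).
  by exists 1 => _ [y _ <-].
apply/seteqP; split=> [x|_ [y ay <-]]; last first.
  rewrite /superlevel/= /zadeh_fun; case: pselect => [?|[]]; last by exists y.
  by apply: le_trans ay _; apply: ub_le_sup => //; exists y.
rewrite /superlevel/= /zadeh_fun; case: pselect => [[y0 fy0] ax|?]; last first.
  by rewrite leNgt a0.
(* Cutting the fibre at height [a / 2] makes it compact. It stays non-empty because the supremum is
   at least [a], and the values cut off do not exceed the maximum on [C]. *)
pose C := superlevel u (a / 2) `&` f @^-1` [set x].
have cC : compact C.
  apply: compact_closedI; first by apply: compact_superlevel; rewrite ?divr_gt0.
  apply: (proj1 (continuous_closedP f) hf).
  by apply: accessible_closed_set1; apply: hausdorff_accessible;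
    exact: metric_hausdorff.
have a2 : 0 < a / 2 by rewrite divr_gt0.
have fiber_sup : has_sup (u @` (f @^-1` [set x])).
  by split=> //; exists (u y0), y0.
have [_ [y1 fy1 <-] y1a] := sup_adherent a2 fiber_sup.
have [|y [y_ge fy] ymax] := usc_compact_max (normal_fuzzy_usc hu) cC.
  exists y1; split=> //; rewrite /superlevel/=.
  apply/ltW/(le_lt_trans _ y1a); by rewrite lerBrDr -splitr.
exists y => //; apply: le_trans ax _.
apply: ge_sup; first by exists (u y0), y0.
move=> _ [z fz <-]; have [az|/ltW za] := leP (a / 2) (u z).
  exact: ymax.
exact: le_trans za y_ge.
Qed.

Lemma iter_zadeh_superlevel n (u : fuzzy X) a : 0 < a ->
  superlevel (iter n (zadeh hf) u) a = iter n f @` superlevel u a.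
Proof.
move=> a0; elim: n => [|n IHn] /=; first by rewrite image_id.
rewrite zadeh_superlevel//; last exact: fuzzyP.
by rewrite IHn image_comp.
Qed.

End zadeh_levels.

Lemma indic_superlevel K a : 0 < a <= 1 -> superlevel (\1_K) a = K.
Proof.
move=> /andP[a0 a1]; apply/seteqP; split=> x; rewrite /superlevel/= indicE.
  by case: (asboolP (K x)) => // nKx; rewrite memNset// leNgt a0.
by move=> Kx; rewrite mem_set.
Qed.

Lemma indic_normal K :
  compact K -> K !=set0 -> normal_fuzzy (\1_K : X -> R).
Proof.
move=> cK K0.
have K_closed : closed K by apply: compact_closed cK; exact: metric_hausdorff.
split.
- by move=> x; rewrite indicE; case: (_ \in _); rewrite ?lexx ler01.
- move=> x a; rewrite indicE; case: (asboolP (K x)) => [Kx|nKx].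
    rewrite mem_set//= => a1; apply: nearW => y; rewrite indicE.
    by apply: le_lt_trans a1; case: (_ \in _).
  rewrite memNset//= => a0.
  have : (~` K) x by [].
  move: K_closed; rewrite -openC openE => /(_ x) /[apply].
  by apply: filterS => y nKy; rewrite indicE memNset.
- suff -> : level (\1_K : X -> R) 0 = K by [].
  rewrite /level eqxx [RHS](closure_id _).1//; congr closure.
  apply/seteqP; split=> x /=; rewrite indicE; last by move=> Kx; rewrite mem_set.
  by case: (asboolP (K x)) => // nKx; rewrite memNset// ltxx.
- by rewrite level1E indic_superlevel ?ltr01 ?lexx.
Qed.

(** The points [y k] may coincide; taking the largest weight then makes each positive superlevel set
    the image of a set of indices. *)
Definition simple_fuzzy N (y : 'I_N -> X) (a : 'I_N -> R) (x : X) : R :=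
  \big[Num.max/0]_(k < N | y k == x) a k.

Lemma simple_fuzzy_superlevel N (y : 'I_N -> X) (a : 'I_N -> R) b : 0 < b ->
  superlevel (simple_fuzzy y a) b = y @` [set k | b <= a k].
Proof.
move=> b0; apply/seteqP; split=> [x bx|_ [k ab <-]]; last first.
  by apply/bigmax_geP; right; exists k.
case/bigmax_geP: bx => [|[k /eqP yk ab]]; first by rewrite leNgt b0.
by exists k.
Qed.

Lemma simple_fuzzy_normal N (y : 'I_N -> X) (a : 'I_N -> R) :
  (forall k, 0 <= a k <= 1) -> (exists k, 1 <= a k) ->
  normal_fuzzy (simple_fuzzy y a).
Proof.
move=> a01 [k ak].
have simple_ge0 x : 0 <= simple_fuzzy y a x by exact: bigmax_ge_id.
have fin_superlevel b : 0 < b -> finite_set (superlevel (simple_fuzzy y a) b).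
  move=> b0; rewrite simple_fuzzy_superlevel//.
  exact/finite_image/finite_finset.
have closed_fin A : finite_set A -> closed A.
  apply: (accessible_finite_set_closed.1 _); apply: hausdorff_accessible.
  exact: metric_hausdorff.
split.
- move=> x; rewrite simple_ge0/=; apply: bigmax_le => // i _.
  by have /andP[] := a01 i.
- move=> x b xb; have b0 : 0 < b by exact: le_lt_trans xb.
  have := closed_fin _ (fin_superlevel _ b0).
  rewrite -openC openE => /(_ x) /= open_x; apply: filterS (open_x _) => [z|].
    by move=> /= /negP; rewrite -ltNge.
  by apply/negP; rewrite -ltNge.
- have fin_supp : finite_set [set x | 0 < simple_fuzzy y a x].
    apply: (@sub_finite_set _ _ (range y)); last exact/finite_image/finite_finset.
    move=> x /= x0; have : superlevel (simple_fuzzy y a) (simple_fuzzy y a x) x.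
      exact: lexx.
    by rewrite simple_fuzzy_superlevel// => -[i _ <-]; exists i.
  rewrite /level eqxx -(closure_id _).1; last exact: closed_fin.
  exact: finite_compact.
- by exists (y k); rewrite level1E simple_fuzzy_superlevel//; exists k.
Qed.

End fuzzy_level_sets.

(** * The two distances and the level at height 1 *)

Section fuzzy_distances.
Variables (R : realType) (X : metricType R).
Implicit Types (u v : X -> R) (A B K : set X).

Lemma increasing_homeo_id : increasing_homeo (@id R).
Proof.
by split=> //; exists id; split=> //;
  apply: continuous_subspaceT => x; exact: cvg_id.
Qed.

(** The identity reparametrization shows that the infimum defining [dist_skorokhod] is over a
    non-empty set and is at most [dist_sup]. *)
Lemma skorokhod_id u v : [/\ increasing_homeo (@id R),
  sup [set `|a - a| | a in `[0, 1]] <= dist_sup u v &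
  dist_sup u v <= dist_sup u v].
Proof.
split; [exact: increasing_homeo_id| |exact: lexx].
apply: ge_sup.
  by exists `|0 - 0 : R|, 0 => //=; rewrite in_itv/= lexx ler01.
by move=> _ [a _ <-]; rewrite subrr normr0; exact: dist_sup_ge0.
Qed.

Lemma dist_skorokhod_le_sup u v : dist_skorokhod u v <= dist_sup u v.
Proof.
apply: ge_inf; last by exists id; exact: skorokhod_id.
exists 0 => r [xi [_ + _]]; apply: le_trans.
by apply: sup_ge0 => _ [a _ <-].
Qed.


Lemma compact_dist_bounded p K : compact K ->
  exists M, forall x, K x -> mdist p x < M.
Proof.
move=> /compact_near_coveringP /(_ R +oo (fun M x => mdist p x < M) _).
case=> [x _|M [_ KM]].
  exists (ball x 1, [set M | mdist p x + 1 < M]) => /=.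
    by split; [exact: nbhsx_ballx|by apply: nbhs_pinfty_gt; exact: num_real].
  move=> [y M] /=; rewrite ballEmdist /= => -[xy pM].
  by apply: le_lt_trans (metric_triangle p x y) _; lra.
by exists (M + 1); apply: KM; rewrite ltrDl.
Qed.

(** The bound [M] makes the suprema genuine: an unbounded set would have supremum 0 and the distance
    would control nothing. *)
Lemma hausdorff_dist_within M e A B : A !=set0 -> B !=set0 ->
  (forall x y, A x -> B y -> mdist x y <= M) -> hausdorff_dist A B < e ->
  within_dist e A B /\ within_dist e B A.
Proof.
have one_side A' B' x : B' !=set0 ->
    (forall x y, A' x -> B' y -> mdist x y <= M) ->
    sup [set point_dist x B' | x in A'] < e -> A' x ->
    exists2 y, B' y & mdist x y < e.
  move=> [y0 By0] ABM ABe Ax.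
  have : point_dist x B' < e.
    apply: le_lt_trans ABe; apply: ub_le_sup; last by exists x.
    exists M => _ [z Az <-].
    exact: le_trans (point_dist_le _ By0) (ABM _ _ Az By0).
  by case/inf_lt => [|_ [y By <-] xy]; [exists (mdist x y0), y0|exists y].
move=> A0 B0 ABM; rewrite gt_max => /andP[ABe BAe]; split=> [x Ax|y By].
  exact: one_side B0 ABM ABe Ax.
by apply: one_side A0 _ BAe By => y' x' By' Ax'; rewrite metric_sym ABM.
Qed.

Lemma superlevel1_neq0 u : normal_fuzzy u -> superlevel u 1 !=set0.
Proof. by move=> hu; rewrite -level1E; exact: normal_fuzzy_neq0. Qed.

Lemma level_subset0 u a : 0 <= a -> level u a `<=` level u 0.
Proof.
rewrite le_eqVlt => /predU1P[<-//|a0] x.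
rewrite /level eqxx gt_eqF// => ax; apply: subset_closure => /=.
exact: lt_le_trans ax.
Qed.

Lemma superlevel1_subset u a : a <= 1 -> superlevel u 1 `<=` level u a.
Proof.
move=> a1 x ux; rewrite /level; case: eqP => _; last exact: le_trans ux.
by apply: subset_closure; exact: lt_le_trans ux.
Qed.

(** The common compact set bounds the Hausdorff distances at all heights, so their supremum
    dominates the one at height 1. Normality is not assumed, which allows [v] to be a reparametrized
    function. *)
Lemma dist_sup_within u v e : superlevel u 1 !=set0 -> superlevel v 1 !=set0 ->
  (exists K, compact K /\ level u 0 `|` level v 0 `<=` K) -> dist_sup u v < e ->
  within_dist e (superlevel u 1) (superlevel v 1) /\
  within_dist e (superlevel v 1) (superlevel u 1).
Proof.
move=> [x ux] [y vy] [K [cK uvK]] uve.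
have [M KM] := compact_dist_bounded x cK.
have bounded a : 0 <= a ->
    forall z t, level u a z -> level v a t -> mdist z t <= M + M.
  move=> a0 z t /(level_subset0 a0) uz /(level_subset0 a0) vt.
  apply: le_trans (metric_triangle z x t) _; rewrite (metric_sym z x).
  by apply/ltW/ltrD; apply/KM/uvK; [left|right].
have level_neq0 (w : X -> R) z a : a <= 1 -> superlevel w 1 z -> level w a !=set0.
  by move=> a1 wz; exists z; exact: (superlevel1_subset a1 wz).
have hausdorff_lt : hausdorff_dist (level u 1) (level v 1) < e.
  apply: le_lt_trans uve; apply: ub_le_sup; last first.
    by exists 1 => //=; rewrite in_itv/= ler01 lexx.
  (* The extra 1 provides the strict inequality in [within_dist]. *)
  exists (M + M + 1) => _ [a /= + <-]; rewrite in_itv/= => /andP[a0 a1].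
  have [[z uz] [t vt]] := (level_neq0 u x a a1 ux, level_neq0 v y a a1 vy).
  apply: hausdorff_dist_le; [by exists z|by exists t| |].
    by move=> z' uz'; exists t => //; have := bounded _ a0 _ _ uz' vt; lra.
  move=> t' vt'; exists z => //; rewrite metric_sym.
  by have := bounded _ a0 _ _ uz vt'; lra.
rewrite -!level1E; apply: hausdorff_dist_within hausdorff_lt.
- exact: level_neq0 ux.
- exact: level_neq0 vy.
- exact: bounded.
Qed.

(** A preimage [zeta 0 > 0] of 0 would force [xi 0 < 0]; the argument at 1 is symmetric. *)
Lemma increasing_homeo01 (xi : R -> R) :
  increasing_homeo xi -> xi 0 = 0 /\ xi 1 = 1.
Proof.
have i0 : (0 : R) \in `[0, 1] by rewrite in_itv/= lexx ler01.
have i1 : (1 : R) \in `[0, 1] by rewrite in_itv/= lexx ler01.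
move=> [xi_lt [zeta [xi01 zeta01 [_ zetaK] _ _]]]; split; apply/eqP.
  have /= := zeta01 _ i0; rewrite in_itv/= => /andP[z0 z1].
  move: z0; rewrite le_eqVlt => /predU1P[z0|z0].
    by have := zetaK _ i0; rewrite -z0 => ->.
  have /= := xi01 _ i0; rewrite in_itv/= => /andP[xi0_ge0 _].
  by have := xi_lt _ _ i0 (zeta01 _ i0) z0; rewrite zetaK// ltNge xi0_ge0.
have /= := zeta01 _ i1; rewrite in_itv/= => /andP[z0 z1].
move: z1; rewrite le_eqVlt => /predU1P[z1|z1].
  by have := zetaK _ i1; rewrite z1 => ->.
have /= := xi01 _ i1; rewrite in_itv/= => /andP[_ xi1_le1].
by have := xi_lt _ _ (zeta01 _ i1) i1 z1; rewrite zetaK// ltNge xi1_le1.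
Qed.

(* Reparametrizing the levels does not move the level at height [1]. *)
Lemma dist_skorokhod_within u v e : normal_fuzzy u -> normal_fuzzy v ->
  dist_skorokhod u v < e ->
  within_dist e (superlevel u 1) (superlevel v 1) /\
  within_dist e (superlevel v 1) (superlevel u 1).
Proof.
move=> hu hv; case/inf_lt => [|r [xi [xi_homeo _ uvr]] re].
  exists (dist_sup u v), id; exact: skorokhod_id.
have v01 x : v x \in `[0, 1] by rewrite in_itv/= normal_fuzzy01.
have [xi0 xi1] := increasing_homeo01 xi_homeo.
have xi_level1 : superlevel (xi \o v) 1 = superlevel v 1.
  have i1 : (1 : R) \in `[0, 1] by rewrite in_itv/= lexx ler01.
  apply/seteqP; split=> x; rewrite /superlevel/= => v_ge.
    rewrite leNgt; apply/negP => v_lt.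
    by have := xi_homeo.1 _ _ (v01 x) i1 v_lt; rewrite xi1 ltNge v_ge.
  have /eqP -> : v x == 1.
    by rewrite eq_le v_ge; have /andP[_ ->] := normal_fuzzy01 hv x.
  by rewrite xi1.
rewrite -xi_level1; apply: dist_sup_within (le_lt_trans uvr re).
- exact: superlevel1_neq0.
- by rewrite xi_level1; exact: superlevel1_neq0.
(* Since [xi 0 = 0], reparametrizing does not enlarge the support of [v]. *)
exists (level u 0 `|` level v 0); split.
  by apply: compactU; exact: normal_fuzzy_compact.
apply: setUS; rewrite /level eqxx; apply: closure_subset => x /= xi_gt0.
rewrite lt_neqAle; have /andP[-> _] := normal_fuzzy01 hv x.
by rewrite andbT; apply/eqP => v0; move: xi_gt0; rewrite -v0 xi0 ltxx.
Qed.

(** A Lebesgue number argument: for small [e] the [e]-neighbourhood of the compact [K] stays in the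
    union, and the [e]-ball around a chosen point of each [K] in [V i] stays in [V i]. *)
Lemma vietoris_set_within N (V : 'I_N -> set X) (K : hyperspace X) :
  (forall i, open (V i)) -> vietoris_set V K ->
  exists2 e : R, 0 < e & forall L : hyperspace X,
    within_dist e K L -> within_dist e L K -> vietoris_set V L.
Proof.
move=> oV [KV KVi].
have open_ball (W : set X) x : open W -> W x ->
    exists2 r : R, 0 < r & forall y, mdist x y < r -> W y.
  move=> oW Wx; have /nbhs_ballP[r /= r0 rW] := open_nbhs_nbhs (conj oW Wx).
  by exists r => // y xy; apply: rW; rewrite ballEmdist.
have cover_near : \forall e \near (0 : R)^'+,
    K `<=` [set x | forall y, mdist x y < e -> (\bigcup_i V i) y].
  have /compact_near_coveringP := @hyper_compact _ K.
  apply=> x /KV Vx.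
  have [r r0 rV] := open_ball _ x (bigcup_open (fun i _ => oV i)) Vx.
  have r2 : 0 < r / 2 by rewrite divr_gt0.
  exists (ball x (r / 2), [set e | e < r / 2]) => /=.
    by split; [exact: nbhsx_ballx|exact: nbhs_right_lt].
  move=> [z e] /=; rewrite ballEmdist /= => -[xz er] y zy; apply: rV.
  by apply: le_lt_trans (metric_triangle x z y) _; lra.
have /choice[x Kx] := KVi.
have points_near : \forall e \near (0 : R)^'+,
    forall i y, mdist (x i) y < e -> V i y.
  apply: filter_forall => i; have [r r0 rV] := open_ball _ _ (oV i) (Kx i).2.
  near=> e => y xy; apply: rV; apply: lt_trans xy _.
  by near: e; exact: nbhs_right_lt.
near (0 : R)^'+ => e; exists e; first by near: e; exact: nbhs_right_gt.
have K_cover : K `<=` [set x | forall y, mdist x y < e -> (\bigcup_i V i) y].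
  by near: e.
have K_points : forall i y, mdist (x i) y < e -> V i y by near: e.
move=> L KL LK; split=> [y /LK[z Kz]|i].
  by rewrite metric_sym; exact: K_cover.
by have [y Ly /K_points Vy] := KL _ (Kx i).1; exists y.
Unshelve. all: by end_near. Qed.

End fuzzy_distances.

(** * Transfer of return sets to and from fuzzy sets *)

Section fuzzy_recurrence.
Variables (R : realType) (X : metricType R) (f : X -> X).
Hypothesis hf : continuous f.

Lemma return_set_zadeh_sup_power (U : set (fuzzy_sup X)) :
  open U -> U !=set0 -> exists (N : nat) (W : set (power X N)),
    [/\ (0 < N)%N, open W, W !=set0 &
      return_set (@power_map X f N) W `<=` return_set (zadeh_sup hf) U].
Proof.
move=> oU [u Uu]; have [e e0 eU] := (oU : dist_open _ U) u Uu.
(* Net and return each cost [d], and [dist_sup_le] doubles the sum: [4 * d < e]. *)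
pose d := e / 5; have d0 : 0 < d by rewrite divr_gt0.
have hu := fuzzyP (u : fuzzy X).
have [s us] := fuzzy_net hu d0.
have [x1] := normal_fuzzy_neq0 hu; rewrite level1E => ux1.
(* A net point of height 1: the net is non-empty and the simple fuzzy set built on it is normal. *)
have [y1 y1s [_ uy1]] := us x1 (lt_le_trans ltr01 ux1).
pose x (k : 'I_(size s)) := nth x1 s k.
have s_nth y : y \in s -> exists k, x k = y.
  move=> ys; have ys' : (index y s < size s)%N by rewrite index_mem.
  by exists (Ordinal ys'); rewrite /x nth_index.
have [k1 xk1] := s_nth _ y1s.
pose a k := fuzzy_fun u (x k).
exists (size s), (box (fun k => (ball (x k) d)°)); split.
- by apply: leq_ltn_trans (ltn_ord k1).
- by apply: open_box => k; exact: open_interior.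
- by exists x => k; exact: nbhsx_ballx.
move=> [l n] [y xy].
have hv : normal_fuzzy (simple_fuzzy y a).
  apply: simple_fuzzy_normal => [k|]; first exact: normal_fuzzy01.
  by exists k1; rewrite /a xk1; exact: le_trans uy1.
exists (Fuzzy hv : fuzzy_sup X) => j jl; apply: eU => /=.
have {}xy k : mdist (x k) (iter (j * n) f (y k)) < d.
  have /interior_subset := xy j jl k.
  by rewrite iter_power_map ballEmdist.
set w := iter _ _ _.
have wE b : 0 < b -> superlevel (fuzzy_fun (w : fuzzy X)) b =
    iter (j * n) f @` (y @` [set k | b <= a k]).
  move=> b0; rewrite -simple_fuzzy_superlevel//.
  exact: (iter_zadeh_superlevel hf (j * n) (Fuzzy hv)).
have dd0 : 0 < d + d by rewrite addr_gt0.
apply: (@le_lt_trans _ _ (d + d + (d + d))); last by rewrite /d; lra.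
apply: dist_sup_le => //.
- by exists x1.
- rewrite wE//; exists (iter (j * n) f (y k1)), (y k1) => //.
  by exists k1 => //=; rewrite /a xk1; exact: le_trans uy1.
(* The net point [x k] near [z] is at least as high as [z], so its weight keeps [y k] in the
   superlevel set at [b], and the orbit of [y k] returns near [x k]. *)
- move=> b b0 z bz; have [y' /s_nth[k <-] [zx uzx]] := us z (lt_le_trans b0 bz).
  exists (iter (j * n) f (y k)).
    by rewrite wE//; exists (y k) => //; exists k => //; exact: le_trans uzx.
  by apply: le_lt_trans (metric_triangle z (x k) _) _; rewrite ltrD.
- move=> b b0 z; rewrite wE// => -[_ [k bk <-] <-]; exists (x k) => //.
  by rewrite metric_sym; apply: lt_trans (xy k) _; rewrite ltrDl.
Qed.

Lemma open_skorokhod_sup (U : set (fuzzy X)) :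
  open (U : set (fuzzy_skorokhod X)) -> open (U : set (fuzzy_sup X)).
Proof.
move=> oU; suff : dist_open (fun u v : fuzzy X => dist_sup u v) U by [].
move=> u Uu; have [e e0 eU] := (oU : dist_open _ U) u Uu.
exists e => // v /= uv; apply: eU => /=.
by apply: le_lt_trans uv; exact: dist_skorokhod_le_sup.
Qed.

(** This is a semiconjugacy from [zadeh hf] onto [hyper_map hf], continuous already for the
    Skorokhod topology; open sets are pulled back along it. *)
Definition level_one (u : fuzzy X) : hyperspace X :=
  Hyperspace (compact_superlevel (fuzzyP u) ltr01)
    (superlevel1_neq0 (fuzzyP u)).

Lemma eq_hyperspace (K L : hyperspace X) : K = L :> set X -> K = L.
Proof.
case: K L => [K cK K0] [L cL L0] /= KL; subst L.
by congr Hyperspace; exact: Prop_irrelevance.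
Qed.

Lemma level_one_iter n (u : fuzzy X) :
  level_one (iter n (zadeh hf) u) = iter n (hyper_map hf) (level_one u).
Proof.
by apply: eq_hyperspace; rewrite iter_hyper_map /= iter_zadeh_superlevel.
Qed.

Lemma open_level_one (U : set (hyperspace X)) : open U ->
  open ([set u | U (level_one u)] : set (fuzzy_skorokhod X)).
Proof.
move=> oU; suff : dist_open (fun u v : fuzzy X => dist_skorokhod u v)
  [set u | U (level_one u)] by [].
move=> u Uu; have [N [V [_ oV uV VU]]] := vietoris_subset oU Uu.
have [e e0 eV] := vietoris_set_within (fun i => (oV i).1) uV.
exists e => // v /= uv; apply/VU/eV.
- exact: (dist_skorokhod_within (fuzzyP u) (fuzzyP v) uv).1.
- exact: (dist_skorokhod_within (fuzzyP u) (fuzzyP v) uv).2.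
Qed.

Lemma level_one_surjective (K : hyperspace X) :
  exists u : fuzzy X, level_one u = K.
Proof.
exists (Fuzzy (indic_normal (@hyper_compact _ K) (@hyper_neq0 _ K))).
by apply: eq_hyperspace => /=; rewrite indic_superlevel// ltr01 lexx.
Qed.

Lemma return_set_hyper_skorokhod (U : set (hyperspace X)) :
  open U -> U !=set0 -> exists W : set (fuzzy_skorokhod X),
    [/\ open W, W !=set0 &
      return_set (zadeh_skorokhod hf) W `<=` return_set (hyper_map hf) U].
Proof.
move=> oU [K UK]; exists [set u | U (level_one u)].
split; first exact: open_level_one.
  by have [u uK] := level_one_surjective K; exists u; rewrite /= uK.
move=> [l n] [u Uu]; exists (level_one u) => j /Uu /=.
by rewrite -level_one_iter.
Qed.

End fuzzy_recurrence.

(** * The equivalence for an arbitrary monotone property *)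

Section return_property_equivalence.
Variables (R : realType) (X : metricType R) (f : X -> X).
Hypothesis hf : continuous f.
Variable P : set (nat * nat) -> Prop.
Hypothesis P_mono : forall S T : set (nat * nat), S `<=` T -> P S -> P T.

Lemma return_property_equiv :
  [<-> forall N : nat, (0 < N)%N -> return_property (@power_map X f N) P;
       return_property (hyper_map hf) P;
       return_property (zadeh_sup hf) P;
       return_property (zadeh_skorokhod hf) P].
Proof.
(* Needed twice: to reach fuzzy sets from the hyperspace through powers, and to close the cycle. *)
have hyper_power : return_property (hyper_map hf) P ->
    forall N, (0 < N)%N -> return_property (@power_map X f N) P.
  move=> hyperP N N0 U oU U0.
  have [W [oW W0 WU]] := return_set_power_hyper hf N0 oU U0.
  exact: P_mono WU (hyperP _ oW W0).
tfae.
- move=> powerP U oU U0.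
  have [N [W [N0 oW W0 WU]]] := return_set_hyper_power hf oU U0.
  exact: P_mono WU (powerP _ N0 _ oW W0).
- move=> /hyper_power powerP U oU U0.
  have [N [W [N0 oW W0 WU]]] := return_set_zadeh_sup_power hf oU U0.
  exact: P_mono WU (powerP _ N0 _ oW W0).
(* Both maps are [zadeh hf], so the return set of [U] is the same for the two topologies. *)
- by move=> supP U oU U0; exact: supP (open_skorokhod_sup oU) U0.
- move=> skorokhodP; apply: hyper_power => U oU U0.
  have [W [oW W0 WU]] := return_set_hyper_skorokhod hf oU U0.
  exact: P_mono WU (skorokhodP _ oW W0).
Qed.

End return_property_equivalence.

Theorem corollary4p2 (R : realType) (X : metricType R) (f : X -> X)
    (hf : continuous f) :
  [/\ [<-> forall N : nat, (0 < N)%N ->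
             topologically_recurrent (@power_map X f N);
           topologically_recurrent (hyper_map hf);
           topologically_recurrent (zadeh_sup hf);
           topologically_recurrent (zadeh_skorokhod hf)],
      [<-> forall N : nat, (0 < N)%N ->
             multiply_recurrent (@power_map X f N);
           multiply_recurrent (hyper_map hf);
           multiply_recurrent (zadeh_sup hf);
           multiply_recurrent (zadeh_skorokhod hf)]
    & forall A : set (set nat), furstenberg_family A ->
      [<-> forall N : nat, (0 < N)%N ->
             family_recurrent (@power_map X f N) A;
           family_recurrent (hyper_map hf) A;
           family_recurrent (zadeh_sup hf) A;
           family_recurrent (zadeh_skorokhod hf) A]].
Proof.
have power_iff (p q : forall Y : topologicalType, (Y -> Y) -> Prop) :
    (forall Y g, p Y g <-> q Y g) ->
    [<-> forall N : nat, (0 < N)%N -> q _ (@power_map X f N);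
         q _ (hyper_map hf); q _ (zadeh_sup hf); q _ (zadeh_skorokhod hf)] ->
    [<-> forall N : nat, (0 < N)%N -> p _ (@power_map X f N);
         p _ (hyper_map hf); p _ (zadeh_sup hf); p _ (zadeh_skorokhod hf)].
  move=> pq [q01 [q12 [q23 q30]]].
  tfae.
  - by move=> pN; apply/pq/q01 => N N0; apply/pq; exact: pN.
  - by move=> /pq/q12/pq.
  - by move=> /pq/q23/pq.
  - by move=> /pq/q30 qN N N0; apply/pq; exact: qN.
split.
- apply: (power_iff _ _ (fun Y g => topologically_recurrentE g)).
  apply: return_property_equiv => S T ST [n n0 Sn].
  by exists n => //; exact: ST.
- apply: (power_iff _ _ (fun Y g => multiply_recurrentE g)).
  apply: return_property_equiv => S T ST Sl l /Sl[n n0 Sn].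
  by exists n => //; exact: ST.
- move=> A [A_up _].
  apply: (power_iff _ _ (fun Y g => family_recurrentE g A)).
  apply: return_property_equiv => S T ST AS.
  by apply: A_up AS _ => n; exact: ST.
Qed.
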